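(* Let $\varrho$ be an aperiodic, primitive, bijective substitution of constant length $L\geqslant 2$ on the finite alphabet $\mathcal{A}$, with hull $\mathbb{X}_\varrho\subseteq\mathcal{A}^{\mathbb{Z}}$. If $\mathcal{S}(\mathbb{X}_\varrho)\simeq\mathbb{Z}\times G$, where $\mathbb{Z}$ is generated by the shift and $G$ is identified with the group of permutations $\tau$ of $\mathcal{A}$ whose letter-exchange maps $\tau_\infty$ belong to $\mathcal{S}(\mathbb{X}_\varrho)$, then $G$ acts freely on $\mathcal{A}$ (a permutation in $G$ with a fixed letter is the identity), and the order of $G$ divides $|\mathcal{A}|$.
   Context: Let $\mathcal{A}$ be a finite alphabet. A substitution of constant length $L$ is a map $\varrho\colon\mathcal{A}\to\mathcal{A}^L$, extended to words by concatenation. It is primitive if there is $k\geqslant 1$ such that $\varrho^k(a)$ contains every letter of $\mathcal{A}$ for every $a\in\mathcal{A}$. Its columns are the maps $\varrho_j\colon\mathcal{A}\to\mathcal{A}$, $\varrho_j(a)=\varrho(a)_j$, for $0\leqslant j\leqslant L-1$; $\varrho$ is bijective if every column is a bijection of $\mathcal{A}$. The hull $\mathbb{X}_\varrho\subseteq\mathcal{A}^{\mathbb{Z}}$ is the set of all $x\in\mathcal{A}^{\mathbb{Z}}$ all of whose finite subwords are subwords of some $\varrho^k(a)$, $k\geqslant 1$, $a\in\mathcal{A}$; it carries the product topology and the shift $\sigma$, $\sigma(x)_m=x_{m+1}$. It (and $\varrho$) is called aperiodic if no $x\in\mathbb{X}_\varrho$ satisfies $\sigma^n(x)=x$ for some $n\neq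 0$. The symmetry group $\mathcal{S}(\mathbb{X}_\varrho)$ is the group of all homeomorphisms $f\colon\mathbb{X}_\varrho\to\mathbb{X}_\varrho$ with $f\circ\sigma=\sigma\circ f$. For a bijection $\tau\colon\mathcal{A}\to\mathcal{A}$, the letter-exchange map is $\tau_\infty\big((x_j)_{j}\big)=(\tau(x_j))_{j}$. It is known that, for aperiodic, primitive, bijective $\varrho$, $\mathcal{S}(\mathbb{X}_\varrho)$ is the direct product of $\langle\sigma\rangle\simeq\mathbb{Z}$ with the finite group of those letter-exchange maps $\tau_\infty$ that map $\mathbb{X}_\varrho$ to itself. *)

(* Defs.v *)
From HB Require Import structures.
From mathcomp Require Import all_boot all_order all_fingroup all_algebra.
From mathcomp Require Import all_classical topology.

Set Implicit Arguments.
Unset Strict Implicit.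
Unset Printing Implicit Defensive.

Import GRing.Theory.
Local Open Scope classical_set_scope.
Local Open Scope ring_scope.

Section Words.
Context {A : finType} {L : nat}.
Variable rho : A -> L.-tuple A.

Definition subst_word (w : seq A) : seq A := flatten [seq tval (rho a) | a <- w].

(* The word obtained by applying rho k times to the letter a. *)
Definition subst_iter (k : nat) (a : A) : seq A := iter k subst_word [:: a].

Definition primitive_subst : Prop :=
  exists2 k : nat, (1 <= k)%N & forall a b : A, b \in subst_iter k a.

Definition column (j : 'I_L) (a : A) : A := tnth (rho a) j.

Definition bijective_subst : Prop := forall j : 'I_L, bijective (column j).

End Words.

(* Bi-infinite sequences, with the product of the discrete topologies. *)
Definition full_shift (A : finType) : topologicalType :=
  {ptws int -> discrete_topology A}.

Section FullShift.
Context {A : finType}.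
Implicit Type x : full_shift A.

(* The n-th power of the shift, for any integer n. *)
Definition zshift (n : int) x : full_shift A := fun m : int => x (m + n).

Definition letter_exchange (tau : {perm A}) x : full_shift A :=
  fun m : int => tau (x m).

Definition subword x (m : int) (n : nat) : seq A :=
  mkseq (fun i : nat => x (m + i%:Z)) n.

End FullShift.

Section Hull.
Context {A : finType} {L : nat}.
Variable rho : A -> L.-tuple A.

Definition hull : set (full_shift A) :=
  [set x | forall (m : int) (n : nat), exists k : nat, exists a : A,
     (1 <= k)%N /\ infix (subword x m n) (subst_iter rho k a)].

Definition aperiodic : Prop :=
  forall x : full_shift A, hull x -> forall n : int, n != 0 -> zshift n x <> x.

Lemma hull_zshift (n : int) (x : hull) : zshift n (set_val x) \in hull.
Proof.
apply/mem_set => m l.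
have [k [a [k1 xl]]] := set_valP x (m + n) l.
exists k, a; split=> //; rewrite (_ : subword _ _ _ = subword (set_val x) (m + n) l) //.
by apply: eq_mkseq => i; rewrite /zshift addrAC.
Qed.

(* As a type, hull carries the subspace topology. *)
Definition hull_shift (x : hull) : hull := SigSub (hull_zshift 1 x).

Definition homeomorphism (X Y : topologicalType) (f : X -> Y) : Prop :=
  continuous f /\
  exists g : Y -> X, [/\ continuous g, cancel f g & cancel g f].

Definition symmetries : set (hull -> hull) :=
  [set f | homeomorphism f /\ f \o hull_shift = hull_shift \o f].

Definition letter_exchange_symmetry (tau : {perm A}) : Prop :=
  exists2 f : hull -> hull, symmetries f &
    forall x : hull, set_val (f x) = letter_exchange tau (set_val x).

Definition letter_exchange_set : {set {perm A}} :=
  [set tau : {perm A} | `[< letter_exchange_symmetry tau >]]%SET.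

Lemma letter_exchange_group_set : group_set letter_exchange_set.
Proof.
apply/group_setP; split.
  rewrite !inE; exists id.
    split; last by [].
    by split; [move=> x; exact: cvg_id | exists id; split=> // x; exact: cvg_id].
  by move=> x; apply/funext => m; rewrite /letter_exchange perm1.
move=> s t; rewrite !inE => -[f [[cf [f' [cf' fK f'K]]] fS] fE].
move=> [g [[cg [g' [cg' gK g'K]]] gS] gE].
exists (g \o f); last first.
  by move=> x; rewrite /= gE fE; apply/funext => m; rewrite /letter_exchange permM.
split; last first.
  apply/funext => x /=.
  have /= -> := congr1 (fun h => h x) fS.
  by have /= -> := congr1 (fun h => h (f x)) gS.
split; first by move=> x; exact: continuous_comp (cf x) (cg (f x)).
exists (f' \o g'); split.
- by move=> x; exact: continuous_comp (cg' x) (cf' (g' x)).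
- by move=> x /=; rewrite gK fK.
- by move=> x /=; rewrite f'K g'K.
Qed.

Canonical letter_exchange_group : {group {perm A}} :=
  Group letter_exchange_group_set.

(* There is a group isomorphism phi from Z x G, with G the group above, onto the
   group of symmetries (under composition) that sends (1, 1) to the shift and
   (0, tau) to the letter-exchange map of tau.  The product t * s of {perm A} is
   the composite of t followed by s, hence the order of the factors. *)
Definition symmetries_split : Prop :=
  exists phi : int * {perm A} -> hull -> hull,
  [/\ set_bij [set p | p.2 \in letter_exchange_group] symmetries phi,
      forall (m n : int) (s t : {perm A}),
        s \in letter_exchange_group -> t \in letter_exchange_group ->
        phi (m + n, (t * s)%g) = phi (m, s) \o phi (n, t),
      phi (1, 1%g) = hull_shift &
      forall tau : {perm A}, tau \in letter_exchange_group ->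
        forall x : hull, set_val (phi (0, tau) x) = letter_exchange tau (set_val x)].

End Hull.

(* Main.v *)
Require Import Defs.
From mathcomp Require Import all_boot all_fingroup.
From mathcomp Require Import all_algebra all_classical topology zify ring.

(** Let C_s (s < N = L^k) be the columns of rho^k, with k a primitivity exponent.
    A point x of the hull and its image tau x are both concatenations of blocks
    rho^k(y_i), resp. rho^k(y'_i). If the two block grids were offset, bijectivity
    of the columns would give y_{i+1} = beta(y_i) for a fixed permutation beta, so
    x would be periodic. Hence the grids coincide and tau C_s(y_i) = C_s(y'_i) for
    all s < N. A letter fixed by tau occurs as some C_s(y_0), which forces
    y'_0 = y_0; as every letter occurs in rho^k(y_0), tau fixes all letters.
    Freeness makes every orbit as large as the group, whence the divisibility. *)

Set Implicit Arguments.
Unset Strict Implicit.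
Unset Printing Implicit Defensive.

Import GRing.Theory.

(** * Words cut into blocks of equal length, and columns of iterates *)

Lemma size_flatten_const (T S : Type) (N : nat) (F : T -> seq S) (w : seq T) :
  (forall b, size (F b) = N) -> size (flatten (map F w)) = size w * N.
Proof. by move=> szF; elim: w => //= b w IH; rewrite size_cat szF IH mulSn. Qed.

Lemma nth_flatten_const (T S : Type) (N : nat) (F : T -> seq S) (w : seq T)
    (t0 : T) (d : S) (q s : nat) :
  (forall b, size (F b) = N) -> q < size w -> s < N ->
  nth d (flatten (map F w)) (q * N + s) = nth d (F (nth t0 w q)) s.
Proof.
move=> szF qw sN; elim: w q qw => //= b w IH [|q] qw; rewrite nth_cat szF.
  by rewrite mul0n add0n sN.
by rewrite mulSn -addnA ltnNge leq_addr /= addKn IH.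
Qed.

Section Iterates.
Context {A : finType} {L : nat}.
Variable rho : A -> L.-tuple A.

Lemma iter_subst_word (k : nat) (w : seq A) :
  iter k (subst_word rho) w = flatten [seq subst_iter rho k b | b <- w].
Proof.
have catE u v : iter k (subst_word rho) (u ++ v) =
    iter k (subst_word rho) u ++ iter k (subst_word rho) v.
  by elim: k => //= k ->; rewrite /subst_word map_cat flatten_cat.
elim: w => [|b w IH] /=; first by elim: k {catE} => //= k ->.
by rewrite -cat1s catE IH.
Qed.

Lemma subst_iterD (k l : nat) (a : A) :
  subst_iter rho (k + l) a =
  flatten [seq subst_iter rho k b | b <- subst_iter rho l a].
Proof. by rewrite -iter_subst_word /subst_iter iterD. Qed.

Lemma size_subst_iter (k : nat) (a : A) : size (subst_iter rho k a) = L ^ k.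
Proof.
elim: k => //= k IH; rewrite /subst_word (@size_flatten_const _ _ L) ?IH ?expnSr //.
by move=> b; rewrite size_tuple.
Qed.

(** By induction, the letter at [s] is column [s %% L] of [rho] applied to the letter at [s %/ L]
    one level down: a composite of bijections. *)
Lemma nth_subst_iter_inj (a0 : A) (k s : nat) :
  bijective_subst rho -> s < L ^ k ->
  injective (fun b => nth a0 (subst_iter rho k b) s).
Proof.
move=> hbij; elim: k s => [|k IH] s sN b c.
  by move: sN; rewrite expn0 ltnS leqn0 => /eqP ->.
have L0 : 0 < L by case: (posnP L) sN => // ->; rewrite exp0n.
have qN : s %/ L < L ^ k by rewrite ltn_divLR // -expnSr.
have szrho e : size (tval (rho e)) = L by rewrite size_tuple.
have rL : s %% L < L by rewrite ltn_mod.
rewrite /= {1 2}(divn_eq s L) /subst_word.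
rewrite !(@nth_flatten_const _ _ L _ _ a0) ?size_subst_iter //.
have tnthE e : nth a0 (rho e) (s %% L) = column rho (Ordinal rL) e.
  by rewrite /column (tnth_nth a0).
by rewrite !tnthE => /(bij_inj (hbij _)) /(IH _ qN).
Qed.

End Iterates.

Local Open Scope ring_scope.

(** * Block decompositions of points of the hull *)

Section Blocks.
Context {A : finType} {L : nat}.
Variable rho : A -> L.-tuple A.

Definition in_blocks (k j : nat) (y : int -> A) (x : int -> A) : Prop :=
  forall (i : int) (s : nat) (d : A), (s < L ^ k)%N ->
    x (i * (L ^ k)%:Z - j%:Z + s%:Z) = nth d (subst_iter rho k (y i)) s.

Lemma hull_window (x : full_shift A) (k n : nat) :
  (1 < L)%N -> hull rho x ->
  exists2 j : nat, (j < L ^ k)%N & forall i : int,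
    - n%:Z <= i * (L ^ k)%:Z - j%:Z ->
    i * (L ^ k)%:Z - j%:Z + (L ^ k)%:Z <= n%:Z ->
    exists b : A, forall s d, (s < L ^ k)%N ->
      x (i * (L ^ k)%:Z - j%:Z + s%:Z) = nth d (subst_iter rho k b) s.
Proof.
move=> L1 hx.
have N0 : (0 < L ^ k)%N by rewrite expn_gt0 (ltn_trans _ L1).
(* The padding makes the window longer than [L ^ k], which forces [k <= l] below. *)
set n' := (n + L ^ k)%N.
have [l [a [_ /infixP[pre [suf E]]]]] := hx (- n'%:Z) (n' + n')%N.
have szE := size_subst_iter rho l a.
have szw : (size pre + (n' + n') + size suf)%N = (L ^ l)%N.
  by rewrite -szE E !size_cat size_mkseq !addnA.
have kl : (k <= l)%N by rewrite -(leq_exp2l _ _ L1) -szw /n'; lia.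
have xE d t : (t < n' + n')%N ->
    x (- n'%:Z + t%:Z) = nth d (subst_iter rho l a) (size pre + t).
  move=> tn; rewrite E nth_cat ltnNge leq_addr /= addKn nth_cat size_mkseq tn.
  by rewrite nth_mkseq.
(* Position p of [x] is position [size pre + n'] + p of rho^l(a). With this [j], block [i] of [x] is
   block [i + q] of rho^k(rho^(l-k)(a)). *)
exists ((size pre + n') %% L ^ k)%N; first by rewrite ltn_mod.
set j := (_ %% _)%N; move=> i lo hi.
set q := ((size pre + n') %/ L ^ k)%N.
have jq : (size pre + n' = q * L ^ k + j)%N by exact: divn_eq.
move: (subst_iterD rho k (l - k) a) xE; rewrite subnKC // => -> xE.
have lk : (L ^ l = L ^ (l - k) * L ^ k)%N by rewrite -expnD subnK.
have n'E : n' = (n + L ^ k)%N by [].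
clearbody j q n'; move: (L ^ k)%N (size_subst_iter rho k) N0 n'E lk jq lo hi => N szN.
move=> N0 n'E lk jq lo hi.
have Q0 : 0 <= i + q%:Z by nia.
have QE : (absz (i + q%:Z))%:Z = i + q%:Z by rewrite gez0_abs.
set Q := absz (i + q%:Z) in QE.
have QL : (Q < L ^ (l - k))%N.
  rewrite -(ltn_pmul2r N0) -lk -szw -ltz_nat PoszM QE; nia.
exists (nth a (subst_iter rho (l - k) a) Q) => s d sN.
have [t tE] : exists t : nat, t%:Z = i * N%:Z - j%:Z + s%:Z + n'%:Z.
  by exists (absz (i * N%:Z - j%:Z + s%:Z + n'%:Z)); rewrite gez0_abs //; lia.
rewrite (_ : _ + _ = - n'%:Z + t%:Z); last by rewrite tE; ring.
rewrite (xE d); last by lia.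
rewrite (_ : (size pre + t = Q * N + s)%N).
  by rewrite (@nth_flatten_const _ _ N _ _ a) ?size_subst_iter.
apply/eqP; rewrite -eqz_nat !PoszD PoszM QE tE; apply/eqP.
have : (size pre)%:Z = q%:Z * N%:Z + j%:Z - n'%:Z by lia.
by move=> ->; ring.
Qed.

(** Compactness over the finitely many offsets: if each [j] failed on some window, the offset found
    for the largest of these windows would contradict its own failure. *)
Lemma hull_in_blocks (x : full_shift A) (k : nat) :
  (1 < L)%N -> hull rho x ->
  exists2 j : nat, (j < L ^ k)%N & exists y : int -> A, in_blocks k j y x.
Proof.
move=> L1 hx; set N := (L ^ k)%N.
pose good (n j : nat) := forall i : int,
    - n%:Z <= i * N%:Z - j%:Z -> i * N%:Z - j%:Z + N%:Z <= n%:Z ->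
    exists b : A, forall s d, (s < N)%N ->
      x (i * N%:Z - j%:Z + s%:Z) = nth d (subst_iter rho k b) s.
have [j gj] : exists j : 'I_N, forall n, good n j.
  apply/not_existsP => bad.
  have /choice[n nP] (j : 'I_N) : exists n, ~ good n j by apply/existsNP/bad.
  have [j jN gj] := hull_window k (\max_j n j) L1 hx.
  apply: (nP (Ordinal jN)) => i /= lo hi; have := leq_bigmax (F := n) (Ordinal jN).
  set m := n _ in lo hi * => mM.
  by apply: gj; rewrite -/N; lia.
exists j => //.
have /choice[y yP] (i : int) : exists b : A, forall s d, (s < N)%N ->
      x (i * N%:Z - j%:Z + s%:Z) = nth d (subst_iter rho k b) s.
  by have := gj (absz (i * N%:Z - j%:Z)%R + N)%N i; apply; lia.
by exists y => i s d sN; apply: yP.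
Qed.

(** * Periodicity forced by offset grids *)

Lemma in_blocks_periodic (k j : nat) (y : int -> A) (x : full_shift A) (n : int) :
  (0 < L)%N -> in_blocks k j y x -> (forall i, y (i + n) = y i) ->
  zshift (n * (L ^ k)%:Z) x = x.
Proof.
move=> L0 xy yn; apply/funext => m; rewrite /zshift.
have N0 : (L ^ k)%:Z != 0 by rewrite -lt0n expn_gt0 L0.
set i := ((m + j%:Z) %/ (L ^ k)%:Z)%Z; set r := ((m + j%:Z) %% (L ^ k)%:Z)%Z.
have rE : (absz r)%:Z = r by rewrite gez0_abs // modz_ge0.
have rN : (absz r < L ^ k)%N by rewrite -ltz_nat rE ltz_pmod //; lia.
have mE : m = i * (L ^ k)%:Z - j%:Z + (absz r)%:Z.
  rewrite rE -[LHS](addrK j%:Z) (divz_eq (m + j%:Z) (L ^ k)%:Z) -/i -/r; ring.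
rewrite [in RHS]mE (xy _ _ (y i) rN).
rewrite (_ : m + _ = (i + n) * (L ^ k)%:Z - j%:Z + (absz r)%:Z).
  by rewrite (xy _ _ (y i) rN) yn.
by rewrite {1}mE; ring.
Qed.

(** The sequence [y] is an orbit of the permutation f^-1 g of a finite set, so the order of that
    permutation is a period. *)
Lemma perm_orbit_periodic (y : int -> A) (f g : A -> A) :
  injective f -> injective g -> (forall i, f (y (i + 1)) = g (y i)) ->
  exists2 n : int, n != 0 & forall i, y (i + n) = y i.
Proof.
move=> fI gI fg; pose b := (perm gI * (perm fI)^-1)%g.
have yS i : y (i + 1) = b (y i).
  by apply: (@perm_inj _ (perm fI)); rewrite permM permKV !permE.
exists #[b]%g%:Z; first by rewrite -lt0n order_gt0.
move=> i; rewrite -[RHS]perm1 -(expg_order b); elim: #[b]%g => [|n IH].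
  by rewrite addr0 expg0 perm1.
by rewrite -addn1 PoszD addrA yS IH expgD expg1 [RHS]permM.
Qed.

(* A block of the image straddles a boundary of [x]: its letter determines, by
   bijectivity of the columns, the letters of both blocks of [x] it meets, and is
   determined by either of them. *)
Lemma offset_blocks_periodic (k j j' : nat) (y y' : int -> A)
    (x : full_shift A) (tau : {perm A}) :
  (0 < L)%N -> bijective_subst rho -> (j < j' < L ^ k)%N ->
  in_blocks k j y x -> in_blocks k j' y' (letter_exchange tau x) ->
  exists2 n : int, n != 0 & zshift n x = x.
Proof.
move=> L0 hbij /andP[jj' j'N] xy xy'; set N := (L ^ k)%N in j'N *.
pose C s b := nth (y 0) (subst_iter rho k b) s.
have CI s : (s < N)%N -> injective (C s) by move=> sN; apply: nth_subst_iter_inj.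
have rN : (j' - j < N)%N by lia.
have rN' : (N - (j' - j) < N)%N by lia.
have N0 : (0 < N)%N by lia.
(* Compare letters at two boundaries: position i N - j starts block i of [x], and position (i + 1) N
   - j' starts block i + 1 of the image. *)
have e1 i : tau (C 0%N (y i)) = C (j' - j)%N (y' i).
  rewrite /C -(xy _ _ _ N0) -(xy' _ _ _ rN) /letter_exchange.
  by congr (tau (x _)); lia.
have e2 i : tau (C (N - (j' - j))%N (y i)) = C 0%N (y' (i + 1)).
  rewrite /C -(xy _ _ _ rN') -(xy' _ _ _ N0) /letter_exchange.
  by congr (tau (x _)); rewrite -/N mulrDl; lia.
pose c r (rN : (r < N)%N) := perm (CI r rN).
pose f b := (c _ rN)^-1%g (tau (C 0%N b)).
pose g b := (c _ N0)^-1%g (tau (C (N - (j' - j))%N b)).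
have fy i : f (y i) = y' i.
  by apply: (@perm_inj _ (c _ rN)); rewrite permKV e1 permE.
have gy i : g (y i) = y' (i + 1).
  by apply: (@perm_inj _ (c _ N0)); rewrite permKV e2 permE.
have [||i|n n0 yn] := @perm_orbit_periodic y f g.
- by move=> b b' /perm_inj/perm_inj/(CI _ N0).
- by move=> b b' /perm_inj/perm_inj/(CI _ rN').
- by rewrite fy gy.
exists (n * N%:Z); last exact: in_blocks_periodic xy yn.
by rewrite mulf_neq0 // -lt0n.
Qed.

(** * Existence of a point in the hull *)

Local Open Scope classical_set_scope.

(* The point is a limit, along a free ultrafilter, of the words rho^n(a), the n-th
   of them starting at position -n. *)
Lemma hull_nonempty (a : A) : (1 < L)%N -> hull rho !=set0.
Proof.
move=> L1.
have [U [UU /= infU]] := @ultraFilterLemma _ \oo _.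
pose u (n : nat) (m : int) := nth a (subst_iter rho n a) (absz (m + n%:Z)).
have /choice[x xP] (m : int) : exists b, U [set n | u n m = b].
  apply/not_existsP => bad.
  (* An ultrafilter contains each set or its complement, and the alphabet is finite. *)
  have : U [set n | forall b, u n m <> b].
    apply: filter_forall => b.
    by have [/bad|] := in_ultra_setVsetC [set n | u n m = b] UU.
  by move=> /filter_ex[n /(_ (u n m))].
exists x => m n.
have : U [set l | (absz m + n < l)%N /\ forall i : 'I_n, u l (m + i%:Z) = x (m + i%:Z)].
  apply: filterI; first by apply: infU; exists (absz m + n).+1.
  by apply: filter_forall => i; apply: xP.
move=> /filter_ex[l [ml ul]]; exists l, a; split; first by lia.
(* Hence rho^l(a), placed from -l on, covers [-l, l), which contains the window. *)
have l2 : (l + l <= L ^ l)%N.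
  apply: leq_trans (_ : 2 ^ l <= _)%N; last by rewrite leq_exp2r //; lia.
  case: l {ul} ml => // l _; elim: l => // l; rewrite [in X in _ -> X]expnS; lia.
apply/infixP; pose w := subst_iter rho l a.
have [p pE] : exists p : nat, p%:Z = m + l%:Z.
  by exists (absz (m + l%:Z)); rewrite gez0_abs //; lia.
have szw : size w = (L ^ l)%N by exact: size_subst_iter.
exists (take p w), (drop (p + n) w).
have -> : subword x m n = take n (drop p w).
  apply: (@eq_from_nth _ a) => [|i]; rewrite size_mkseq ?size_takel ?size_drop ?szw //; first by lia.
  move=> iN; rewrite nth_mkseq // -(ul (Ordinal iN)) nth_take // nth_drop /u /=.
  by congr nth; lia.
by rewrite addnC -drop_drop !cat_take_drop.
Qed.

End Blocks.

(** * Freeness of the action, then divisibility *)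

Section Freeness.
Context {A : finType} {L : nat}.
Variable rho : A -> L.-tuple A.
Hypotheses (hL : (2 <= L)%N) (hprim : primitive_subst rho).
Hypotheses (hbij : bijective_subst rho) (haper : aperiodic rho).

Lemma letter_exchange_hull (tau : {perm A}) (x : full_shift A) :
  tau \in letter_exchange_group rho -> hull rho x ->
  hull rho (letter_exchange tau x).
Proof.
rewrite inE => /asboolP[f _ fE] hx.
by rewrite -(fE (SigSub (mem_set hx))); apply: set_valP.
Qed.

Lemma letter_exchange_group_free (tau : {perm A}) (a : A) :
  tau \in letter_exchange_group rho -> tau a = a -> tau = 1%g.
Proof.
move=> tauG taua; have [k _ kP] := hprim.
have [x hx] := hull_nonempty rho a hL.
have hx' := letter_exchange_hull tauG hx.
have [j jN [y xy]] := hull_in_blocks k hL hx.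
have [j' j'N [y' xy']] := hull_in_blocks k hL hx'.
have jj' : j = j'.
  apply/eqP; rewrite eqn_leq; apply/andP; split; rewrite leqNgt; apply/negP => lt.
    (* When j' < j the roles are exchanged: [x] is the image of tau x under the inverse of [tau],
       and tau x would be periodic. *)
    have xE : x = letter_exchange tau^-1%g (letter_exchange tau x).
      by apply/funext => m; rewrite /letter_exchange permK.
    rewrite xE in xy.
    have [|n n0] := offset_blocks_periodic (ltnW hL) hbij _ xy' xy.
      by rewrite lt.
    exact: haper hx' n n0.
  have [|n n0] := offset_blocks_periodic (ltnW hL) hbij _ xy xy'.
    by rewrite lt.
  exact: haper hx n n0.
subst j'.
have occ b c : exists2 s, (s < L ^ k)%N & nth a (subst_iter rho k b) s = c.
  have /(nthP a)[s] := kP b c; rewrite size_subst_iter => sN sE.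
  by exists s.
have tauC i s : (s < L ^ k)%N -> tau (nth a (subst_iter rho k (y i)) s) =
    nth a (subst_iter rho k (y' i)) s.
  by move=> sN; rewrite -(xy _ _ _ sN) -(xy' _ _ _ sN).
have yy' : y 0 = y' 0.
  have [s sN sE] := occ (y 0) a.
  apply: (nth_subst_iter_inj hbij sN (a0 := a)).
  by rewrite -tauC // sE taua.
apply/permP => c; have [s sN sE] := occ (y 0) c.
by rewrite perm1 -{1}sE tauC // -yy'.
Qed.

End Freeness.

Lemma dvdn_card_free (A : finType) (G : {group {perm A}}) :
  (forall tau, tau \in G -> forall a, tau a = a -> tau = 1%g) ->
  (#|G| %| #|A|)%N.
Proof.
move=> free; rewrite -cardsT.
have act : [acts G, on [set: A]%SET | 'P].
  by apply/actsP => tau _ b; rewrite !inE.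
rewrite -(acts_sum_card_orbit act); apply: dvdn_sum => _ /imsetP[b _ ->].
rewrite card_orbit (_ : 'C_G[b | 'P]%g = 1%g) ?indexg1 //.
apply/trivgP/fintype.subsetP => tau; rewrite inE => /andP[tauG /astab1P tb].
by rewrite inE; apply/eqP/(free tau tauG b).
Qed.

Close Scope ring_scope.

Theorem theorem14 (A : finType) (L : nat) (rho : A -> L.-tuple A)
    (hL : 2 <= L)
    (hprim : primitive_subst rho)
    (hbij : bijective_subst rho)
    (haper : aperiodic rho)
    (hsplit : symmetries_split rho) :
  (forall tau : {perm A}, tau \in letter_exchange_group rho ->
     forall a : A, tau a = a -> tau = 1%g) /\
  #|letter_exchange_group rho| %| #|A|.
Proof.
have free tau : tau \in letter_exchange_group rho ->
    forall a : A, tau a = a -> tau = 1%g.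
  by move=> tauG a; exact: letter_exchange_group_free tauG.
by split=> //; apply: dvdn_card_free.
Qed.
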